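(* Let $n\geq 2$ and let $S_{n,2}$ be the free metabelian group on $n$ generators. For every $m \in \mathbb{N}$ there is a $2$-generated subgroup $H$ of $S_{n,2}$ such that $\Delta_H^{S_{n,2}}(l) \succeq l^{m}$.
   Context: $S_{n,2}=F/F''$, where $F$ is the free group of rank $n$ and $F''$ its second derived subgroup. For a group $G$ with finite generating set $T$ and a subgroup $H$ with finite generating set $S$, the distortion function is $\Delta_H^G(l)=\max\{|w|_S : w\in H, |w|_T\le l\}$, where $|\cdot|_S,|\cdot|_T$ are word lengths. For non-decreasing functions $f,g$ on the nonnegative integers, $f\preceq g$ (equivalently $g\succeq f$) means there is an integer $C>0$ with $f(l)\le Cg(Cl)$ for all $l\ge 0$. *)

(* Defs.v *)
From HB Require Import structures.
From mathcomp Require Import all_boot all_order.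
From mathcomp Require Import boolp classical_sets functions cardinality.

Set Implicit Arguments.
Unset Strict Implicit.
Unset Printing Implicit Defensive.

Local Open Scope classical_set_scope.
Local Open Scope group_scope.
Local Open Scope quotient_scope.

Section Subgroups.
Variable G : groupType.
Implicit Types (A H N : set G) (x y : G).

Definition subgroup H : Prop :=
  [/\ H 1, (forall x y, H x -> H y -> H (x * y)) & forall x, H x -> H x^-1].

Definition generated A : set G := smallest subgroup A.

Definition derived H : set G :=
  generated [set [~ x, y] | x in H & y in H].

Definition normal N : Prop := subgroup N /\ forall x y, N x -> N (x ^ y).

Lemma subgroup_generated A : subgroup (generated A).
Proof.
split=> [H [[]]|x y Hx Hy H HA|x Hx H HA] //.
- by case: HA.1 => _ HM _; apply: HM; [apply: Hx|apply: Hy].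
- by case: HA.1 => _ _; apply; apply: Hx.
Qed.

Lemma normal_setT : normal [set: G].
Proof. by []. Qed.

Lemma normal_derived N : normal N -> normal (derived N).
Proof.
move=> [_ NJ]; split=> [|x y]; first exact: subgroup_generated.
suff : derived N `<=` [set z | derived N (z ^ y)] by exact.
have [D1 DM DV] := subgroup_generated [set [~ x, y] | x in N & y in N].
apply: smallest_sub => [|z [u Nu [v Nv <-]]] /=.
  split=> [|u v|u] /=; rewrite ?conj1g ?conjMg ?conjVg //.
  - exact: DM.
  - exact: DV.
rewrite conjRg; apply: sub_gen_smallest.
by exists (u ^ y); [exact: NJ|exists (v ^ y); [exact: NJ|]].
Qed.

End Subgroups.

(* [word_length T g] is |g|_T, the least length of a word in the letters of T
   and their inverses with value g; it is 0 when g is not in the subgroup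
   generated by T. *)
Section Distortion.
Variable G : groupType.
Implicit Types (S T H : set G) (g : G).

Definition word_over T (s : seq G) : Prop :=
  forall x, x \in s -> T x \/ T x^-1.

Definition nat_min (A : set nat) : nat := xget 0%N (A `&` lbound A).
Definition nat_max (A : set nat) : nat := xget 0%N (A `&` ubound A).

Definition word_length T g : nat :=
  nat_min [set size s | s in [set s | word_over T s /\ \prod_(x <- s) x = g]].

Definition finite_generating_set S H : Prop :=
  finite_set S /\ generated S = H.

(* T is meant to generate G and S to generate H, both finite, so that the set
   below is finite and contains 0. *)
Definition distortion T S H (l : nat) : nat :=
  nat_max [set word_length S w | w in
           [set w | H w /\ (word_length T w <= l)%N]].

End Distortion.

Definition growth_le (f g : nat -> nat) : Prop :=
  exists2 C : nat, (0 < C)%N & forall l, (f l <= C * g (C * l))%N.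

Section FreeGroup.
Variable X : choiceType.

(* (x, true) stands for the generator x and (x, false) for its inverse. *)
Local Notation letter := (X * bool)%type.
Implicit Types (a b : letter) (s t u : seq letter).

Definition linv a : letter := (a.1, ~~ a.2).

Definition reduced s : bool := sorted (fun a b => b != linv a) s.

Definition lmul a s : seq letter :=
  if s is b :: t then if b == linv a then t else a :: s else [:: a].

Definition wmul s t : seq letter := foldr lmul t s.
Definition winv s : seq letter := rev (map linv s).

Lemma linvK : involutive linv.
Proof. by move=> [x e]; rewrite /linv negbK. Qed.

Lemma lmul_reduced a s : reduced s -> reduced (lmul a s).
Proof.
case: s => [|b s] //= Hs; case: ifP => /= [_|/negbT ->] //.
exact: path_sorted Hs.
Qed.

Lemma wmul_reduced s t : reduced t -> reduced (wmul s t).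
Proof. by move=> Ht; elim: s => //= a s; exact: lmul_reduced. Qed.

Lemma lmulK a s : reduced s -> lmul (linv a) (lmul a s) = s.
Proof.
case: s => [|b s] //= Hs; first by rewrite linvK eqxx.
case: eqP => [eb|_] /=; last by rewrite linvK eqxx.
case: s Hs => [|c s] /=; first by rewrite eb.
by case/andP=> /negbTE cb _; rewrite -eb cb.
Qed.

Lemma wmul_lmul a s t : reduced t -> wmul (lmul a s) t = lmul a (wmul s t).
Proof.
move=> Ht; case: s => [|b s] //=; case: eqP => [->|_] //=.
by rewrite -[in LHS](lmulK (linv a) (wmul_reduced s Ht)) linvK.
Qed.

Lemma wmulA s t u : reduced u -> wmul s (wmul t u) = wmul (wmul s t) u.
Proof. by move=> Hu; elim: s => //= a s IH; rewrite IH wmul_lmul. Qed.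

Lemma wmuls0 s : reduced s -> wmul s [::] = s.
Proof.
elim: s => //= a s IH Hs; rewrite IH; last exact: path_sorted Hs.
by case: s Hs {IH} => //= b s /andP[/negbTE ->].
Qed.

Lemma winvK : involutive winv.
Proof. by move=> s; rewrite /winv map_rev revK mapK //; exact: linvK. Qed.

Lemma winv_reduced s : reduced s -> reduced (winv s).
Proof.
rewrite /reduced /winv rev_sorted sorted_map; apply: sub_sorted => a b /=.
by apply: contraNN => /eqP/(can_inj linvK) ->; rewrite linvK.
Qed.

Lemma wmulVs s : reduced s -> wmul (winv s) s = [::].
Proof.
suff H t : reduced t -> wmul (winv s) (wmul s t) = t.
  by move=> Hs; rewrite -[X in wmul _ X](wmuls0 Hs) H.
move=> Ht; elim: s => //= a s IH.
rewrite /winv /= rev_cons -cats1 /wmul foldr_cat /= -/(wmul s t).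
by rewrite lmulK ?wmul_reduced // -/(wmul _ _) IH.
Qed.

Record freeGroup : Type :=
  FreeGroup { fword :> seq (X * bool); fwordP : reduced fword }.

HB.instance Definition _ := [isSub for fword].
HB.instance Definition _ := [Choice of freeGroup by <:].

Definition fg_one : freeGroup := @FreeGroup [::] isT.
Definition fg_mul (u v : freeGroup) : freeGroup :=
  FreeGroup (wmul_reduced u (fwordP v)).
Definition fg_inv (u : freeGroup) : freeGroup :=
  FreeGroup (winv_reduced (fwordP u)).

Lemma fg_mulA : associative fg_mul.
Proof. by move=> u v w; apply: val_inj; rewrite /= wmulA ?fwordP. Qed.

Lemma fg_mul1 : left_id fg_one fg_mul.
Proof. by move=> u; apply: val_inj. Qed.

Lemma fg_mulr1 : right_id fg_one fg_mul.
Proof. by move=> u; apply: val_inj; rewrite /= wmuls0 ?fwordP. Qed.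

Lemma fg_mulV : left_inverse fg_one fg_inv fg_mul.
Proof. by move=> u; apply: val_inj; rewrite /= wmulVs ?fwordP. Qed.

Lemma fg_mulrV : right_inverse fg_one fg_inv fg_mul.
Proof.
move=> u; have := fg_mulV (fg_inv u).
by congr (fg_mul _ _ = _); apply: val_inj; rewrite /= winvK.
Qed.

HB.instance Definition _ :=
  isGroup.Build freeGroup fg_mulA fg_mul1 fg_mulr1 fg_mulV fg_mulrV.

End FreeGroup.

Section Quotient.
Variables (G : groupType) (N : set G) (nN : normal N).

Definition coset_rel (x y : G) : bool := `[< N (x^-1 * y) >].

Lemma coset_rel_equiv : equiv_class_of coset_rel.
Proof.
have [[N1 NM NV] _] := nN; split=> [x|x y|y x z].
- by apply/asboolP; rewrite mulVg.
- by apply/asboolP/asboolP => /NV; rewrite invgM invgK.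
- move=> /asboolP Nxy /asboolP Nyz; apply/asboolP.
  have -> : x^-1 * z = (x^-1 * y) * (y^-1 * z) by rewrite mulgA mulgK.
  exact: NM.
Qed.

Canonical coset_equiv := EquivRelPack coset_rel_equiv.

Definition quotient : Type := {eq_quot coset_equiv}.
HB.instance Definition _ := Choice.on quotient.
HB.instance Definition _ := EqQuotient.on quotient.

Definition qproj (x : G) : quotient := \pi_quotient x.

Definition qone : quotient := qproj 1.
Definition qmul (p q : quotient) : quotient := qproj (repr p * repr q).
Definition qinv (p : quotient) : quotient := qproj (repr p)^-1.

Lemma qprojP x y : qproj x = qproj y <-> N (x^-1 * y).
Proof.
split=> [/eqmodP/asboolP//|Nxy].
by apply/eqmodP/asboolP.
Qed.

Lemma qprojM : {morph qproj : x y / x * y >-> qmul x y}.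
Proof.
have [[_ NM _] NJ] := nN => x y; apply/qprojP.
have /qprojP Nx : qproj x = qproj (repr (qproj x)) by rewrite /qproj reprK.
have /qprojP Ny : qproj y = qproj (repr (qproj y)) by rewrite /qproj reprK.
set x' := repr _ in Nx *; set y' := repr _ in Ny *.
have -> : (x * y)^-1 * (x' * y') = (x^-1 * x') ^ y * (y^-1 * y').
  by rewrite /conjg invgM !mulgA mulgK.
exact: NM (NJ _ _ Nx) Ny.
Qed.

Lemma qprojV : {morph qproj : x / x^-1 >-> qinv x}.
Proof.
have [[_ _ NV] NJ] := nN => x; apply/qprojP.
have /qprojP Nx : qproj x = qproj (repr (qproj x)) by rewrite /qproj reprK.
set x' := repr _ in Nx *; rewrite invgK.
have -> : x * x'^-1 = (x^-1 * x')^-1 ^ x^-1.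
  by rewrite /conjg invgM !invgK !mulgA mulgK.
exact/NJ/NV.
Qed.

Lemma qproj_surj p : exists x, qproj x = p.
Proof. by exists (repr p); rewrite /qproj reprK. Qed.

Lemma qmulA : associative qmul.
Proof.
move=> p q r; have [x <-] := qproj_surj p; have [y <-] := qproj_surj q.
by have [z <-] := qproj_surj r; rewrite -!qprojM mulgA.
Qed.

Lemma qmul1 : left_id qone qmul.
Proof. by move=> p; have [x <-] := qproj_surj p; rewrite -qprojM mul1g. Qed.

Lemma qmulr1 : right_id qone qmul.
Proof. by move=> p; have [x <-] := qproj_surj p; rewrite -qprojM mulg1. Qed.

Lemma qmulV : left_inverse qone qinv qmul.
Proof.
by move=> p; have [x <-] := qproj_surj p; rewrite -qprojV -qprojM mulVg.
Qed.

Lemma qmulrV : right_inverse qone qinv qmul.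
Proof.
by move=> p; have [x <-] := qproj_surj p; rewrite -qprojV -qprojM mulgV.
Qed.

HB.instance Definition _ :=
  isGroup.Build quotient qmulA qmul1 qmulr1 qmulV qmulrV.

End Quotient.

Definition free_metabelian (n : nat) : groupType :=
  quotient (normal_derived (normal_derived (normal_setT (freeGroup 'I_n)))).

(* Main.v *)
(* Let x, y be two free generators, c = [y, x], w = [c, x, ..., x] with x taken
   m times, and H = <w, x>. The derived subgroup is an abelian normal subgroup,
   hence a Z[x, x^-1]-module in which w = (x - 1)^m c. The element
   v_l = (1 + x + ... + x^(l-1))^m w lies in H, and since v_l = (x^l - 1)^m c =
   [c, x^l, ..., x^l] its length in the whole group is linear in l.
   For the lower bound, map x to the shift and y to a function u : Z -> Z in the
   (unrestricted) wreath product of Z by Z, where u is chosen so that its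
   iterated difference, the image of w, is the constant 1. On H the function
   component is then constant, which gives a homomorphism H -> Z sending v_l to
   l^m; a homomorphism to Z grows at most linearly with word length in H. *)
Require Import Defs.
From mathcomp Require Import all_boot all_order.
From mathcomp Require Import boolp classical_sets functions cardinality.
From HB Require Import structures.
From mathcomp Require Import ssralg ssrint zify.

Set Implicit Arguments.
Unset Strict Implicit.
Unset Printing Implicit Defensive.

Local Open Scope classical_set_scope.

(** * Extrema of sets of natural numbers *)

Lemma finite_nat_set_ub (A : set nat) :
  finite_set A -> exists b, forall k, A k -> k <= b.
Proof.
move=> /finite_seqP[s ->]; exists (\max_(i <- s) i) => k /= ks.
exact: leq_bigmax_seq.
Qed.

Lemma nat_minP (A : set nat) : A !=set0 -> A (nat_min A) /\ lbound A (nat_min A).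
Proof.
move=> [k Ak]; suff : (A `&` lbound A) (nat_min A) by [].
apply: xgetPex.
have exA : exists k, `[< A k >] by exists k; apply/asboolP.
case: (ex_minnP exA) => i /asboolP Ai imin; exists i; split=> // j Aj.
by apply: imin; apply/asboolP.
Qed.

(** The bound [b] guards against the default: on an unbounded set [nat_max] is 0. *)
Lemma nat_max_ge (A : set nat) (b k : nat) :
  (forall j, A j -> j <= b) -> A k -> k <= nat_max A.
Proof.
move=> Ab Ak.
have exA : exists k, `[< A k >] by exists k; apply/asboolP.
have ubA i : `[< A i >] -> i <= b by move=> /asboolP/Ab.
suff [_ ubm] : (A `&` ubound A) (nat_max A) by exact: ubm.
apply: xgetPex; case: (ex_maxnP exA ubA) => i /asboolP Ai imax.
by exists i; split=> // j Aj; apply: imax; apply/asboolP.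
Qed.

(** * Word length, balls and distortion *)

Section WordLength.
Local Open Scope group_scope.
Variable G : groupType.
Implicit Types (S T H : set G) (g h x : G) (s t : seq G).

Lemma subgroup_prod H s : subgroup H -> (forall x, x \in s -> H x) ->
  H (\prod_(x <- s) x).
Proof.
move=> [H1 HM _] Hs; rewrite big_seq_cond.
by apply: big_ind => // x /andP[/Hs].
Qed.

Lemma subgroup_prod_nat H (l : nat) (F : nat -> G) : subgroup H ->
  (forall i, H (F i)) -> H (\prod_(0 <= i < l) F i).
Proof. by move=> [H1 HM _] HF; apply: big_ind. Qed.

Lemma subgroupX H x (k : nat) : subgroup H -> H x -> H (x ^+ k).
Proof.
by move=> [H1 HM HV] Hx; elim: k => // k IH; rewrite expgS; apply: HM.
Qed.

Lemma word_over_cat T s t : word_over T s -> word_over T t -> word_over T (s ++ t).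
Proof. by move=> Ts Tt x; rewrite mem_cat => /orP[/Ts|/Tt]. Qed.

Lemma word_over_inv T s : word_over T s -> word_over T (rev [seq x^-1 | x <- s]).
Proof.
move=> Ts x; rewrite mem_rev => /mapP[y /Ts Ty ->].
by rewrite invgK; case: Ty; [right|left].
Qed.

Lemma prod_inv_word s : \prod_(x <- rev [seq x^-1 | x <- s]) x = (\prod_(x <- s) x)^-1.
Proof.
elim: s => [|x s IH]; first by rewrite !big_nil invg1.
by rewrite /= rev_cons -cats1 big_cat IH big_seq1 big_cons invgM.
Qed.

Lemma generated_word T g : generated T g ->
  exists2 s, word_over T s & \prod_(x <- s) x = g.
Proof.
move=> Tg; apply: (Tg [set g | exists2 s, word_over T s & \prod_(x <- s) x = g]).
split=> [|x Tx /=]; last first.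
  exists [:: x]; last by rewrite big_seq1.
  by move=> y; rewrite inE => /eqP->; left.
split=> [|x y [s Ts <-] [t Tt <-]|x [s Ts <-]] /=.
- by exists [::]; rewrite ?big_nil.
- by exists (s ++ t); [exact: word_over_cat|rewrite big_cat].
- by exists (rev [seq x^-1 | x <- s]); [exact: word_over_inv|rewrite prod_inv_word].
Qed.

Lemma word_length_le T s : word_over T s ->
  word_length T (\prod_(x <- s) x) <= size s.
Proof.
move=> Ts; have mem : [set size s | s in [set t | word_over T t /\
    \prod_(x <- t) x = \prod_(x <- s) x]] (size s) by exists s.
by have [_] := nat_minP (ex_intro _ _ mem); apply.
Qed.

Lemma word_length_attained T g : generated T g ->
  exists s, [/\ word_over T s, \prod_(x <- s) x = g & size s = word_length T g].
Proof.
move=> /generated_word[s Ts sg].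
have [|[t [Tt tg] st] _] := @nat_minP
  [set size s | s in [set s | word_over T s /\ \prod_(x <- s) x = g]].
  by exists (size s), s.
by exists t.
Qed.

Section Generating.
Variable T : set G.
Hypothesis genT : generated T = [set: G].

Let word g :
  exists s, [/\ word_over T s, \prod_(x <- s) x = g & size s = word_length T g].
Proof. by apply: word_length_attained; rewrite genT. Qed.

Lemma word_lengthM g h :
  word_length T (g * h) <= word_length T g + word_length T h.
Proof.
have [s [Ts sg <-]] := word g; have [t [Tt th <-]] := word h.
by rewrite -sg -th -big_cat -size_cat word_length_le //; apply: word_over_cat.
Qed.

Lemma word_lengthV g : word_length T g^-1 <= word_length T g.
Proof.
have [s [Ts sg <-]] := word g.
rewrite -sg -prod_inv_word -(size_map (fun x => x^-1)) -size_rev word_length_le //.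
exact: word_over_inv.
Qed.

Lemma word_lengthX g (k : nat) : word_length T (g ^+ k) <= k * word_length T g.
Proof.
elim: k => [|k IH].
  by have /word_length_le : word_over T [::] by []; rewrite big_nil.
by rewrite expgS mulSn; apply: leq_trans (word_lengthM _ _) _; rewrite leq_add2l.
Qed.

Lemma word_lengthR g h :
  word_length T [~ g, h] <= 2 * (word_length T g + word_length T h).
Proof.
rewrite mul2n -addnn -addnA commgEl conjgE.
apply: leq_trans (word_lengthM _ _) _; rewrite leq_add ?word_lengthV //.
by apply: leq_trans (word_lengthM _ _) _; rewrite leq_add ?word_lengthV ?word_lengthM.
Qed.

(** Makes the set inside [distortion] finite, so that its [nat_max] is a true maximum. By induction
    on the radius: a nonempty word is a letter, from a finite set, followed by a shorter word. *)
Lemma finite_ball (L : nat) : finite_set T ->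
  finite_set [set g | word_length T g <= L].
Proof.
move=> finT.
have finTV : finite_set (T `|` [set x^-1 | x in T]).
  by rewrite finite_setU; split=> //; apply: finite_image.
suff fin : finite_set [set g | exists s,
    [/\ word_over T s, size s <= L & \prod_(x <- s) x = g]].
  apply: sub_finite_set fin => g /= gL; have [s [Ts sg sL]] := word g.
  by exists s; rewrite sL.
elim: L => [|L IH].
  apply: sub_finite_set (finite_set1 1) => g [[|x s] [_ // _ <-]] /=.
  by rewrite big_nil.
apply: sub_finite_set (_ : finite_set (1 |`
  [set x * g | x in T `|` [set x^-1 | x in T] & g in [set g | exists s,
    [/\ word_over T s, size s <= L & \prod_(x <- s) x = g]]])).
  move=> g [[|x s] [Ts sL <-]] /=; first by left; rewrite big_nil.
  right; exists x; last first.
    exists (\prod_(y <- s) y); last by rewrite big_cons.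
    by exists s; split=> // y ys; apply: Ts; rewrite inE ys orbT.
  have [|Tx|Tx] := Ts x; first by rewrite inE eqxx.
    by left.
  by right; exists x^-1; rewrite ?invgK.
rewrite finite_setU; split; first exact: finite_set1.
exact: finite_image2.
Qed.

Lemma word_length_le_distortion S H (L : nat) g : finite_set T -> H g ->
  word_length T g <= L -> word_length S g <= distortion T S H L.
Proof.
move=> finT Hg gL.
have [|b ub] := @finite_nat_set_ub
    (word_length S @` [set w | H w /\ word_length T w <= L]).
  apply: finite_image; apply: sub_finite_set (finite_ball L finT).
  by move=> w [].
by apply: (nat_max_ge ub); exists g.
Qed.

End Generating.

(** A bound [M] for the absolute value of [f] on [S] also holds on inverses, and additivity then
    sums it along a shortest word. Additivity is asked on [generated S] only, because the map used
    later is a homomorphism on the subgroup but not on the whole group. *)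
Lemma additive_le_word_length S (f : G -> int) : finite_set S ->
  (forall g h, generated S g -> generated S h -> f (g * h) = (f g + f h)%R) ->
  exists M : nat, forall g, generated S g -> absz (f g) <= M * word_length S g.
Proof.
move=> finS fM; have [gen1 genM genV] := subgroup_generated S.
have f1 : f 1 = 0%R.
  have := fM 1 1 gen1 gen1.
  by rewrite mulg1; lia.
have fV g : generated S g -> f g^-1 = (- f g)%R.
  move=> Sg; have := fM _ _ Sg (genV _ Sg).
  by rewrite mulgV f1; lia.
have subS : S `<=` generated S by exact: sub_gen_smallest.
have [|M ub] := @finite_nat_set_ub ((absz \o f) @` S).
  exact: finite_image.
have le_M x : S x \/ S x^-1 -> absz (f x) <= M.
  case=> Sx; first by apply: ub; exists x.
  rewrite -[x]invgK fV ?abszN; last exact: subS.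
  by apply: ub; exists x^-1.
exists M => g /word_length_attained[s [Ss <- <-]].
elim: s Ss => [|x s IH] Ss; first by rewrite big_nil f1.
have Sx : S x \/ S x^-1 by apply: Ss; rewrite inE eqxx.
have {}Ss : word_over S s by move=> y ys; apply: Ss; rewrite inE ys orbT.
have genS y : S y \/ S y^-1 -> generated S y.
  by case=> [/subS//|/subS/genV]; rewrite invgK.
rewrite big_cons fM; first 1 last.
- exact: genS.
- apply: subgroup_prod => [|y /Ss/genS//].
  exact: subgroup_generated.
have := IH Ss; have := le_M x Sx; rewrite /= mulnS; lia.
Qed.

End WordLength.

(** * Module calculus in an abelian normal subgroup *)

Section AbelianNormal.
Local Open Scope group_scope.
Variables (G : groupType) (A : set G) (x : G).
Hypotheses (nA : normal A) (abA : forall a b, A a -> A b -> commute a b).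

(* In the Z[x, x^-1]-module A, [~ a, x ^+ l] is (x^l - 1) a and
   [geom_sum l a] is (1 + x + ... + x^(l-1)) a. *)
Definition geom_sum (l : nat) (a : G) : G := \prod_(0 <= i < l) a ^ (x ^+ i).

Lemma geom_sumS l a : geom_sum l.+1 a = geom_sum l a * a ^ (x ^+ l).
Proof. by rewrite /geom_sum big_nat_recr. Qed.

Lemma normal_conj a y : A a -> A (a ^ y).
Proof. exact: nA.2. Qed.

Lemma normal_comm a y : A a -> A [~ a, y].
Proof.
have [[_ AM AV] _] := nA.
by move=> Aa; rewrite commgEl; apply: AM; [apply: AV|apply: normal_conj].
Qed.

Lemma geom_sum_normal l a : A a -> A (geom_sum l a).
Proof.
by move=> Aa; apply: subgroup_prod_nat => [|i]; [exact: nA.1|exact: normal_conj].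
Qed.

(** The identity (1 + x + ... + x^(l-1)) (x - 1) = x^l - 1: the factors
    [(a ^ (x ^+ i))^-1 * a ^ (x ^+ i.+1)] telescope in the order in which they are multiplied. *)
Lemma geom_sum_comm l a : geom_sum l [~ a, x] = [~ a, x ^+ l].
Proof.
elim: l => [|l IH]; first by rewrite /geom_sum big_nil commg1.
by rewrite geom_sumS IH !commgEl conjMg -conjgM -expgS conjVg mulgA mulgK.
Qed.

Lemma comm_geom_sum l a : A a -> geom_sum l [~ a, x] = [~ geom_sum l a, x].
Proof.
have [[_ AM AV] _] := nA.
move=> Aa; elim: l => [|l IH]; first by rewrite /geom_sum !big_nil comm1g.
rewrite !geom_sumS IH !commgEl (conjMg a^-1) (conjMg (geom_sum l a)) invgM
  conjVg -!conjgM -expgS -expgSr.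
(* The two sides differ only by moving [b^-1] across [s^-1 * s ^ x]; both lie in the abelian [A]. *)
set b := a ^ (x ^+ l); set s := geom_sum l a.
have As : A (s^-1 * s ^ x).
  by apply: AM; [apply: AV|apply: normal_conj]; apply: geom_sum_normal.
have Ab : A b^-1 by apply: AV; apply: normal_conj.
have := abA Ab As; move: (s ^ x) (a ^ (x ^+ l.+1)) => sx bx bs.
by rewrite !mulgA -(mulgA b^-1) bs.
Qed.

(** Each geometric sum is moved inwards past the factors x - 1 until it meets the innermost one,
    which it turns into x^l - 1. *)
Lemma iter_geom_sum_comm m l a : A a ->
  iter m (geom_sum l) (iter m (fun b => [~ b, x]) a) =
  iter m (fun b => [~ b, x ^+ l]) a.
Proof.
have swap k b : A b -> geom_sum l (iter k (fun b => [~ b, x]) b) =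
    iter k (fun b => [~ b, x]) (geom_sum l b).
  move=> Ab; elim: k => //= k <-; apply: comm_geom_sum.
  by elim: k => //= k; apply: normal_comm.
elim: m a => // m IH a Aa; rewrite iterSr (iterSr m (fun b => [~ b, x])).
rewrite swap; last exact: normal_comm.
by rewrite geom_sum_comm IH -?iterSr //; exact: normal_comm.
Qed.

End AbelianNormal.

Lemma word_length_iter_comm (G : groupType) (T : set G) (x a : G) (m l : nat) :
  generated T = [set: G] -> 0 < l ->
  word_length T (iter m (fun b => [~ b, x ^+ l])%g a) <=
  2 ^ m.+1 * (word_length T a + word_length T x) * l.
Proof.
move=> genT l_gt0.
(* Since [[~ b, x ^+ l]] has length at most 2 (|b| + l |x|), the quantity |b| + 2 l |x| at most
   doubles with each commutator, which makes the induction close. *)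
suff H : word_length T (iter m (fun b => [~ b, x ^+ l])%g a) +
     2 * (l * word_length T x) <=
     2 ^ m * (word_length T a + 2 * (l * word_length T x)).
  apply: leq_trans (leq_addr _ _) (leq_trans H _).
  rewrite expnSr -!mulnA leq_pmul2l ?expn_gt0 //.
  move: (word_length T a) (word_length T x) => p q; nia.
elim: m => [|m IH]; first by rewrite expn0 mul1n.
rewrite /= expnS -mulnA.
apply: leq_trans (leq_add (word_lengthR genT _ _) (leqnn _)) _.
apply: leq_trans (leq_mul (leqnn 2) IH).
rewrite -mulnDr leq_mul2l /= -addnA leq_add2l (mul2n (l * _)) -addnn.
by rewrite leq_add2r word_lengthX.
Qed.

(** * Universal properties of free groups and of quotients *)

Section FreeLift.
Local Open Scope group_scope.
Variables (X : choiceType) (K : groupType) (v : X -> K).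
Implicit Types (a : X * bool) (s t : seq (X * bool)) (u : freeGroup X).

Definition letter_val a : K := if a.2 then v a.1 else (v a.1)^-1.
Definition free_lift u : K := \prod_(a <- fword u) letter_val a.

Lemma letter_val_linv a : letter_val (linv a) = (letter_val a)^-1.
Proof. by case: a => y [] /=; rewrite /letter_val /= ?invgK. Qed.

Lemma prod_lmul a s : \prod_(b <- lmul a s) letter_val b =
  letter_val a * \prod_(b <- s) letter_val b.
Proof.
case: s => [|b s] /=; first by rewrite big_seq1 big_nil mulg1.
case: eqP => [->|_]; last by rewrite !big_cons.
by rewrite big_cons letter_val_linv mulVKg.
Qed.

Lemma free_lift1 : free_lift 1 = 1.
Proof. by rewrite /free_lift big_nil. Qed.

Lemma free_liftM : {morph free_lift : u w / u * w}.
Proof.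
move=> u w; rewrite /free_lift /=; elim: (fword u) => [|a s IH] /=.
  by rewrite big_nil mul1g.
by rewrite prod_lmul IH big_cons mulgA.
Qed.

HB.instance Definition _ := isUMagmaMorphism.Build (freeGroup X) K free_lift
  (conj free_lift1 free_liftM).

Definition fg_gen (y : X) : freeGroup X := @FreeGroup X [:: (y, true)] isT.

Lemma free_lift_gen y : free_lift (fg_gen y) = v y.
Proof. by rewrite /free_lift big_seq1. Qed.

End FreeLift.

Section QuotientLift.
Local Open Scope group_scope.
Variables (G K : groupType) (N : set G) (nN : normal N).
Variables (f : UMagmaMorphism.type G K) (fN : forall x, N x -> f x = 1).

Definition quot_lift (p : quotient nN) : K := f (repr p).

(** The value does not depend on the representative: [x] and [repr (qproj nN x)] differ by an
    element of [N], which [f] kills. *)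
Lemma quot_lift_proj x : quot_lift (qproj nN x) = f x.
Proof.
rewrite /quot_lift; have /qprojP/fN : qproj nN x = qproj nN (repr (qproj nN x)).
  by rewrite {2}/qproj reprK.
by rewrite gmulfM gmulfV => /mulg1_eq <-; rewrite invgK.
Qed.

Lemma quot_lift_morph : monoid_morphism quot_lift.
Proof.
split=> [|p q]; first by rewrite [LHS]quot_lift_proj gmulf1.
have [x <-] := qproj_surj p; have [y <-] := qproj_surj q.
by rewrite -[_ * _]qprojM !quot_lift_proj gmulfM.
Qed.

End QuotientLift.

Lemma subgroup_preimage (G K : groupType) (f : UMagmaMorphism.type G K)
  (L : set K) : subgroup L -> subgroup (f @^-1` L).
Proof.
move=> [L1 LM LV]; split=> [|x y Lx Ly|x Lx]; rewrite /preimage /=.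
- by rewrite gmulf1.
- by rewrite gmulfM; apply: LM.
- by rewrite gmulfV; apply: LV.
Qed.

(** * The free metabelian group and its universal property *)

Section Metabelian.
Local Open Scope group_scope.

(** Elements of the derived subgroup of the quotient lift to the derived subgroup of [G], and the
    commutator of two such lifts lies in the second derived subgroup. *)
Lemma commute_derived_quotient (G : groupType) (p q : quotient
    (normal_derived (normal_derived (normal_setT G)))) :
  derived [set: _] p -> derived [set: _] q -> commute p q.
Proof.
set nN := normal_derived _ in p q *.
have sub : derived [set: quotient nN] `<=` qproj nN @` derived [set: G].
  have [D1 DM DV] := subgroup_generated [set [~ x, y] | x in [set: G] & y in [set: G]].
  apply: smallest_sub => [|_ [r _ [s _ <-]]] /=.
    split=> [|_ _ [x Dx <-] [y Dy <-]|_ [x Dx <-]] /=.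
    - by exists 1.
    - by exists (x * y); [exact: DM|exact: qprojM].
    - by exists x^-1; [exact: DV|exact: qprojV].
  have [x <-] := qproj_surj r; have [y <-] := qproj_surj s.
  exists [~ x, y]; last by rewrite /commg /conjg !qprojM !qprojV.
  by apply: sub_gen_smallest; exists x => //; exists y.
move=> /sub[x Dx <-] /sub[y Dy <-]; rewrite /commute -[LHS]qprojM -[RHS]qprojM.
apply/qprojP; rewrite invgM -mulgA; apply: sub_gen_smallest.
by exists y => //; exists x.
Qed.

Variables (n : nat) (K : groupType) (v : 'I_n -> K).
Hypothesis metabK : forall a b c d : K, commute [~ a, b] [~ c, d].

Definition fm_gen (i : 'I_n) : free_metabelian n := qproj _ (fg_gen i).

Lemma free_lift_derived2 x :
  derived (derived [set: freeGroup 'I_n]) x -> free_lift v x = 1.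
Proof.
have abD y z : derived [set: freeGroup 'I_n] y -> derived [set: freeGroup 'I_n] z ->
    commute (free_lift v y) (free_lift v z).
  (* [metabK] speaks of single commutators only. As centralizers are subgroups, it extends to the
     whole derived subgroup in one argument ([D1]), and then in the other. *)
  have centr (B : set K) : subgroup [set a | forall b, B b -> commute a b].
    split=> [b _|a c Ba Bc b Bb|a Ba b Bb] /=.
    - exact/commute_sym/commute1.
    - by apply/commute_sym/commuteM; apply/commute_sym; [apply: Ba|apply: Bc].
    - by apply/commute_sym/commuteV/commute_sym/Ba.
  have D1 c d w : derived [set: freeGroup 'I_n] w ->
      commute (free_lift v w) [~ c, d].
    move=> Dw; have := subgroup_preimage (free_lift v) (centr [set [~ c, d]]).
    move=> sG; suff /(_ _ Dw) : derived [set: freeGroup 'I_n] `<=`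
      free_lift v @^-1` [set a | forall b, [set [~ c, d]] b -> commute a b].
      exact.
    apply: smallest_sub => // _ [r _ [s _ <-]] _ /= ->.
    by rewrite gmulfR; apply: metabK.
  move=> Dy Dz; have := subgroup_preimage (free_lift v) (centr [set free_lift v z]).
  move=> sG; suff /(_ _ Dy) : derived [set: freeGroup 'I_n] `<=`
      free_lift v @^-1` [set a | forall b, [set free_lift v z] b -> commute a b].
    exact.
  apply: smallest_sub => // _ [r _ [s _ <-]] _ /= ->.
  by rewrite gmulfR; apply/commute_sym/D1.
have sub1 : subgroup [set 1 : K].
  by split=> [|_ _ -> ->|_ ->] //=; rewrite ?mulg1 ?invg1.
move: x; apply: (smallest_sub (subgroup_preimage (free_lift v) sub1)).
move=> _ [r Dr [s Ds <-]]; rewrite /preimage /= gmulfR.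
by apply/eqP/commgP/abD.
Qed.

Lemma free_metabelian_lift : exists rho : UMagmaMorphism.type (free_metabelian n) K,
  forall i, rho (fm_gen i) = v i.
Proof.
pose nF'' := normal_derived (normal_derived (normal_setT (freeGroup 'I_n))).
pose f := quot_lift (nN := nF'') (free_lift v).
have fmorph : monoid_morphism f := quot_lift_morph nF'' free_lift_derived2.
pose m := isUMagmaMorphism.Build (free_metabelian n) K f fmorph.
pose rho : UMagmaMorphism.type (free_metabelian n) K := HB.pack f m.
exists rho => i.
by rewrite -(free_lift_gen v) -(quot_lift_proj nF'' free_lift_derived2).
Qed.

End Metabelian.

(** * The unrestricted wreath product and iterated differences *)

Section ShiftGroup.
Import GRing.Theory.
Local Open Scope ring_scope.

(* The unrestricted wreath product of Z by Z: the pair (i, u) acts on Z x Z by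
   (z, t) |-> (z + i, t + u z). *)
Definition shift_group : Type := (int * (int -> int))%type.
HB.instance Definition _ := Choice.on shift_group.
Implicit Types (p q r : shift_group) (u : int -> int).

Definition sg_one : shift_group := (0, fun=> 0).
(** The left factor acts first, so [q.2] is read at the shifted point. *)
Definition sg_mul p q : shift_group := (p.1 + q.1, fun z => p.2 z + q.2 (z + p.1)).
Definition sg_inv p : shift_group := (- p.1, fun z => - p.2 (z - p.1)).

Lemma sg_mulA : associative sg_mul.
Proof.
move=> p q r; congr pair; first exact: addrA.
by apply/funext => z /=; rewrite !addrA.
Qed.

Lemma sg_mul1 : left_id sg_one sg_mul.
Proof.
move=> [i u]; congr pair; first exact: add0r.
by apply/funext => z /=; rewrite add0r addr0.
Qed.

Lemma sg_mulr1 : right_id sg_one sg_mul.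
Proof.
move=> [i u]; congr pair; first exact: addr0.
by apply/funext => z /=; rewrite addr0.
Qed.

Lemma sg_mulV : left_inverse sg_one sg_inv sg_mul.
Proof.
move=> [i u]; congr pair; first exact: addNr.
by apply/funext => z /=; rewrite addNr.
Qed.

Lemma sg_mulrV : right_inverse sg_one sg_inv sg_mul.
Proof.
move=> [i u]; congr pair; first exact: subrr.
by apply/funext => z /=; rewrite addrK subrr.
Qed.

HB.instance Definition _ :=
  isGroup.Build shift_group sg_mulA sg_mul1 sg_mulr1 sg_mulV sg_mulrV.

(** Commutators have shift 0, and pairs with shift 0 multiply by pointwise addition. *)
Lemma sg_metabelian p q r s : commute [~ p, q]%g [~ r, s]%g.
Proof.
have comm1 (a b : shift_group) : ([~ a, b]%g).1 = 0.
  by rewrite /commg /conjg /=; lia.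
case: [~ p, q]%g (comm1 p q) => i u /= ->; case: [~ r, s]%g (comm1 r s) => j w /= ->.
by congr pair; apply/funext => z /=; rewrite addr0 addrC.
Qed.

Definition sg_shift : shift_group := (1, fun=> 0).
Definition sg_base u : shift_group := (0, u).

Lemma sg_baseJ u (l : nat) :
  (sg_base u ^ (sg_shift ^+ l))%g = sg_base (fun z => u (z - l%:Z)).
Proof.
have -> : (sg_shift ^+ l)%g = (l%:Z, fun=> 0).
  elim: l => [//|l IH]; rewrite expgS IH; congr pair => /=; lia.
congr pair; first by rewrite /=; lia.
by apply/funext => z /=; lia.
Qed.

Lemma sg_base_comm u :
  [~ sg_base u, sg_shift]%g = sg_base (fun z => u (z - 1) - u z).
Proof.
rewrite commgEl -[sg_shift in LHS]expg1 sg_baseJ.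
by congr pair; apply/funext => z /=; rewrite !(subr0, addr0) addrC.
Qed.

(** Shifting does not change a constant function, so on this subgroup evaluating the function
    component at 0 is a homomorphism to Z. *)
Lemma subgroup_sg_const : subgroup [set p : shift_group | exists c, p.2 = fun=> c].
Proof.
split=> [|p q [c pc] [d qd]|p [c pc]] /=; first by exists 0.
- by exists (c + d); apply/funext => z; rewrite pc qd.
- by exists (- c); apply/funext => z; rewrite pc.
Qed.

Lemma backward_antidifference (h : int -> int) :
  exists u : int -> int, forall z, u (z - 1) - u z = h z.
Proof.
(* Normalised by u 0 = 0, the recurrence u (z - 1) = u z + h z is solved downwards and upwards;
   [Negz k] stands for -(k+1). The support may be infinite, hence the unrestricted product. *)
exists (fun z => if z is Negz k then \sum_(0 <= i < k.+1) h (- i%:Z)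
  else - \sum_(0 <= i < absz z) h i.+1%:Z).
move=> [[|k]|k].
- by rewrite /= big_nat1 big_nil !oppr0 addr0.
- have -> : k.+1%:Z - 1 = k%:Z by lia.
  by rewrite /= big_nat_recr //= opprK addKr.
- have -> : Negz k - 1 = Negz k.+1 by lia.
  by rewrite /= [X in X - _]big_nat_recr //= addrAC subrr add0r NegzE.
Qed.

Lemma iter_backward_antidifference (m : nat) :
  exists u : int -> int, iter m (fun b => [~ b, sg_shift]%g) (sg_base u) =
    sg_base (fun=> 1).
Proof.
elim: m => [|m [h IH]]; first by exists (fun=> 1).
have [u uh] := backward_antidifference h.
by exists u; rewrite iterSr sg_base_comm (funext uh).
Qed.

(** Constant functions are fixed under conjugation by the shift, so 1 + x + ... + x^(l-1) acts on
    them as multiplication by l. *)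
Lemma geom_sum_sg_const (l : nat) (c : int) :
  geom_sum sg_shift l (sg_base (fun=> c)) = sg_base (fun=> c *+ l).
Proof.
elim: l => [|l IH]; first by rewrite /geom_sum big_nil.
rewrite geom_sumS IH sg_baseJ mulrSr; congr pair.
Qed.

End ShiftGroup.

(** * The distorted subgroup and its two length estimates *)

Theorem corollary1p3 (n m : nat) (n_ge2 : (2 <= n)%N) (m_gt0 : (0 < m)%N) :
  exists H : set (free_metabelian n),
    (exists a b : free_metabelian n, generated [set a; b] = H) /\
    forall T S : set (free_metabelian n),
      finite_generating_set T [set: free_metabelian n] ->
      finite_generating_set S H ->
      growth_le (fun l => (l ^ m)%N) (distortion T S H).
Proof.
(* One difference for [c], itself a commutator with [x], and [m] more for [w]. *)
have [u um] := iter_backward_antidifference m.+1.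
pose i0 : 'I_n := Ordinal (ltnW n_ge2); pose i1 : 'I_n := Ordinal n_ge2.
have [rho rhoE] := free_metabelian_lift
  (fun i => if i == i0 then sg_shift else sg_base u) sg_metabelian.
pose x := fm_gen i0; pose c := [~ fm_gen i1, x]%g.
have rhox : rho x = sg_shift by rewrite rhoE eqxx.
pose w := iter m (fun b => [~ b, x]%g) c.
have rhow : rho w = sg_base (fun=> 1%R).
  rewrite -um iterSr /w.
  elim: (m) => [|k IH]; first by rewrite /= gmulfR rhox rhoE.
  by rewrite !iterS gmulfR rhox IH.
set H := generated [set w; x].
have sH : subgroup H by exact: subgroup_generated.
have Hw : H w by apply: sub_gen_smallest; left.
have Hx : H x by apply: sub_gen_smallest; right.
pose v l := iter m (geom_sum x l) w.
have Hv l : H (v l).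
  rewrite /v; elim: (m) => //= k; move: (iter _ _ _) => a Ha.
  apply: subgroup_prod_nat => // i; have Hxi := subgroupX i sH Hx.
  have [_ HM HV] := sH.
  by apply: (HM); [exact: HV|exact: HM].
have rhov l : rho (v l) = sg_base (fun=> Posz (l ^ m)).
  rewrite /v; elim: (m) => [|k IH]; first by rewrite rhow.
  rewrite iterS /geom_sum gmulf_prod.
  under eq_bigr do rewrite gmulfJ gmulfXn rhox IH.
  rewrite -/(geom_sum _ _ _) geom_sum_sg_const expnSr; congr (sg_base _).
  by apply/funext => z; lia.
have v_comm l : v l = iter m (fun b => [~ b, x ^+ l]%g) c.
  rewrite /v /w (@iter_geom_sum_comm _ (derived [set: _])) //.
  - exact/normal_derived/normal_setT.
  - exact: commute_derived_quotient.
  - by apply: sub_gen_smallest; exists (fm_gen i1) => //; exists x.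
exists H; split; first by exists w, x.
move=> T S [finT genT] [finS genS].
(* Both generators have constant function component: 1 for [w] and 0 for [x]. *)
have H_const : H `<=` rho @^-1` [set p | exists d, p.2 = fun=> d].
  apply: smallest_sub; first exact/subgroup_preimage/subgroup_sg_const.
  move=> _ [->|->]; rewrite /preimage /= ?rhow ?rhox.
    by exists 1%R.
  by exists 0%R.
have [|M le_M] := @additive_le_word_length _ S (fun g => (rho g).2 0%R) finS.
  move=> g h; rewrite genS => /H_const[d gd] /H_const[e he].
  by rewrite gmulfM /= gd he.
pose K := 2 ^ m.+1 * (word_length T c + word_length T x).
(* One constant serves twice: [K] bounds the length of [v l] in the whole group by K l, and [M]
   gives l^m <= M |v l| for the length in [H]. *)
exists (M + K).+1 => // l.
(* At l = 0 the left side vanishes because m > 0; the length bound for [v l] needs l > 0. *)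
case: l => [|l]; first by rewrite exp0n.
have vK : word_length T (v l.+1) <= (M + K).+1 * l.+1.
  rewrite v_comm; apply: leq_trans (word_length_iter_comm _ _ _ genT _) _ => //.
  by rewrite leq_mul2r -/K; lia.
have := word_length_le_distortion genT S finT (Hv l.+1) vK.
have := le_M (v l.+1); rewrite genS rhov /= => /(_ (Hv _)); nia.
Qed.
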